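(* Let $M$ be a $\lambda$-term such that $\mathtt{InferStrong}(M)$ returns $(\Pi,\psi)$, where the root of $\Pi$ is $\mathtt\Gamma\vdash_{\tt p}M:{\tt a}$. Then $\mathsf m\circ\psi(\Pi)$ is a derivation in system $\mathcal N_{\mathsf s}$ of $\mathsf m(\psi(\mathtt\Gamma))\vdash_{\mathsf s}M:\mathsf m(\psi({\tt a}))$.
   Context: $\lambda$-terms: $M,N::=x\mid\lambda x.M\mid MN$. Types $\mathbf T_{\mathsf s}$: $A::=a\mid\mu\to A$, $a$ a type variable, $\mu=[A_1,\dots,A_n]$ ($n\ge1$) a nonempty finite multiset. Type environments map term variables to multisets (all but finitely many empty); $\mathrm{dom}(\Gamma)=\{x\mid\Gamma(x)\neq[\,]\}$; $\uplus$ is pointwise multiset union; $\Gamma,x:\mu$ extends $\Gamma$ with $x\notin\mathrm{dom}(\Gamma)$. System $\mathcal N_{\mathsf s}$: (var) $x:[A]\vdash_{\mathsf s}x:A$; (many) from $\Gamma_i\vdash_{\mathsf s}M:A_i$ ($1\le i\le n$, $n\ge1$) infer $\biguplus_i\Gamma_i\vdash_{\mathsf s}M:[A_1,\dots,A_n]$; (app) from $\Gamma\vdash_{\mathsf s}M:\mu\to A$ and $\Delta\vdash_{\mathsf s}N:\mu$ infer $\Gamma\uplus\Delta\vdash_{\mathsf s}MN:A$; (abs-I) from $\Gamma,x:\mu\vdash_{\mathsf s}M:A$, $\mu\neq[\,]$, infer $\Gamma\vdash_{\mathsf s}\lambda x.M:\mu\to A$; (abs-K) from $\Gamma\vdash_{\mathsf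 s}M:B$, $x\notin\mathrm{dom}(\Gamma)$, $A\in\mathbf T_{\mathsf s}$, infer $\Gamma\vdash_{\mathsf s}\lambda x.M:[A]\to B$. Pre-types: ${\tt A}::={\tt a}\mid\sigma\to{\tt A}$, ${\tt a}$ a pre-type variable, $\sigma=\langle{\tt A}_1,\dots,{\tt A}_n\rangle$ ($n\ge0$) an ordered list; $|\sigma|$ length, $\cdot$ concatenation; pre-type environments map variables to lists, with pointwise concatenation. Disjoint = no common pre-type variable; fresh = occurring nowhere else. Strong pseudo-derivation $(\Pi,E_\Pi)$ for $M$: (var) $x:\langle{\tt a}\rangle\vdash_{\tt p}x:{\tt a}$, $E=\emptyset$; (many) from pairwise disjoint $\Sigma_i\triangleright\mathtt\Gamma_i\vdash_{\tt p}M:{\tt a}_i$ ($n\ge1$) infer $\mathtt\Gamma_1\cdot\ldots\cdot\mathtt\Gamma_n\vdash_{\tt p}M:\langle{\tt a}_1,\dots,{\tt a}_n\rangle$, $E=\bigcup E_{\Sigma_i}$; (app) from disjoint $\Sigma_1\triangleright\mathtt\Gamma\vdash_{\tt p}M:{\tt a}$, $\Sigma_2\triangleright\mathtt\Delta\vdash_{\tt p}N:\langle{\tt b}_1,\dots,{\tt b}_n\rangle$, ${\tt c}$ fresh, infer $\mathtt\Gamma\cdot\mathtt\Delta\vdash_{\tt p}MN:{\tt c}$, $E=E_{\Sigma_1}\cup E_{\Sigma_2}\cup\{{\tt a}\doteq\langle{\tt b}_1,\dots,{\tt b}_n\rangle\to{\tt c}\}$; (abs-I) from $\Sigma\triangleright\mathtt\Gamma,x:\sigma\vdash_{\tt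 p}M:{\tt a}$, $\sigma\neq\langle\rangle$, ${\tt b}$ fresh, infer $\mathtt\Gamma\vdash_{\tt p}\lambda x.M:{\tt b}$, $E=E_\Sigma\cup\{{\tt b}\doteq\sigma\to{\tt a}\}$; (abs-K) from $\Sigma\triangleright\mathtt\Gamma\vdash_{\tt p}M:{\tt a}$, $x\notin\mathrm{dom}(\mathtt\Gamma)$, ${\tt b},{\tt c}$ fresh, infer $\mathtt\Gamma\vdash_{\tt p}\lambda x.M:{\tt c}$, $E=E_\Sigma\cup\{{\tt c}\doteq\langle{\tt b}\rangle\to{\tt a}\}$. Modulo renaming; $\mathrm{PD}^{\mathsf s}_{\min}(M)$ has $n=1$ in all (many) rules. $\mathsf m$ maps pre-types to types: $\mathsf m({\tt a})=a$ (injective), $\mathsf m(\sigma\to{\tt A})=\mathsf m(\sigma)\to\mathsf m({\tt A})$, $\mathsf m(\langle{\tt A}_i\rangle_i)=[\mathsf m({\tt A}_i)]_i$, extended to environments and trees. Substitutions $\psi$ on pre-type variables extend homomorphically. Expansion $\mathsf{Exp}(\sigma,n,\Pi)$ ($\sigma\neq\langle\rangle$, $n\ge1$): if $\sigma=\langle{\tt a}_1,\dots,{\tt a}_m\rangle$ is the conclusion list of a (many) rule of $\Pi$ with subject $N$, replace the subtree there by a (many) rule whose $m+n$ premises are fresh pairwise disjoint copies $\vdash_{\tt p}N:{\tt a}_i$ of $\mathrm{PD}^{\mathsf s}_{\min}(N)$, and recompute the equation set; else unchanged. Unification rules $\to_{\mathsf u}$ on sets of equations: (erase) remove ${\tt A}\doteq{\tt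 A}$; (swap) $\sigma\to{\tt A}\doteq{\tt a}$ becomes ${\tt a}\doteq\sigma\to{\tt A}$; (arrow) $\sigma\to{\tt A}\doteq\tau\to{\tt B}$ becomes $\sigma\doteq\tau,{\tt A}\doteq{\tt B}$; (list) $\langle{\tt A}_1..{\tt A}_n\rangle\doteq\langle{\tt B}_1..{\tt B}_n\rangle$ becomes ${\tt A}_i\doteq{\tt B}_i$; (subs) given ${\tt a}\doteq{\tt A}$ with ${\tt a}\notin\mathsf{Var}({\tt A})$ and ${\tt a}$ occurring in the rest $S$, replace all occurrences of ${\tt a}$ in $S$ by ${\tt A}$. $\to_{\mathsf o}$: same, with (subs) restricted to the case ${\tt a}$ occurs in $S$ outside a list and replacing only occurrences not inside lists. $\mathrm{nf}_{\mathsf u},\mathrm{nf}_{\mathsf o}$ denote the unique normal forms. Blocked form: contains $\sigma\doteq\tau$ with $|\sigma|\neq|\tau|$. Solved form: no list equations, all equations ${\tt a}_i\doteq{\tt B}_i$ with distinct ${\tt a}_i$ not occurring in any ${\tt B}_k$; its most general unifier $\mathrm{mgu}$ maps ${\tt a}_i\mapsto{\tt B}_i$. Algorithm $\mathtt{InferStrong}(M)$ (non-deterministic): $(\Pi,E):=\mathrm{PD}^{\mathsf s}_{\min}(M)$; $E:=\mathrm{nf}_{\mathsf o}(E)$; while $E$ is in blocked form: choose $\sigma\doteq\tau\in E$ with $|\sigma|\neq|\tau|$; if $|\sigma|>|\tau|$ set $(\Pi,E):=\mathsf{Exp}(\tau,|\sigma|-|\tau|,\Pi)$, else $(\Pi,E):=\mathsf{Exp}(\sigma,|\tau|-|\sigma|,\Pi)$;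 then $E:=\mathrm{nf}_{\mathsf o}(E)$. After the loop: $E:=\mathrm{nf}_{\mathsf u}(E)$, $\psi:=\mathrm{mgu}(E)$, return $(\Pi,\psi)$. *)

(* Defs.v *)
From HB Require Import structures.
From Stdlib Require Import Relation_Operators.
From mathcomp Require Import all_boot.
From mathcomp Require Import finmap multiset.

Set Implicit Arguments.
Unset Strict Implicit.
Unset Printing Implicit Defensive.

Local Open Scope mset_scope.
Local Open Scope fset_scope.
Local Open Scope nat_scope.

Definition var := nat.

Inductive term :=
| TVar of var
| TLam of var & term
| TApp of term & term.

(* The domain of an environment is its [finsupp]. *)

Definition env (L : eqType) (d : L) := {fsfun var -> L with d}.

Section Env.
Variables (L : eqType) (d : L).
Implicit Types (G D : env d) (x : var) (l : L).

Definition env0 : env d := [fsfun].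

(* [Γ, x : l]; only used when x is not in the domain of Γ *)
Definition env_ext G x l : env d := [fsfun G with x |-> l].

Definition env1 x l : env d := env_ext env0 x l.

Definition env_op (op : L -> L -> L) G D : env d :=
  [fsfun x in finsupp G `|` finsupp D => op (G x) (D x)].

End Env.

Definition env_map (L L' : eqType) (d : L) (d' : L') (f : L -> L') (G : env d) :
  env d' := [fsfun x in finsupp G => f (G x)].

(* [RAbsK A] records the type A given to the abstracted variable. In a
   pseudo-derivation that type is a fresh pre-type variable b which no sequent
   displays: it only shows up in the equation c = <b> -> a. *)
Inductive rule (T : Type) :=
| RVar | RMany | RApp | RAbsI | RAbsK of T.
Arguments RVar {T}.
Arguments RMany {T}.
Arguments RApp {T}.
Arguments RAbsI {T}.

(* A subject is assigned either a type or a multiset (list) of types. *)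
Record sequent (E T L : Type) := Sequent {
  ctx : E;
  subject : term;
  assigned : T + L
}.

Inductive tree (E T L : Type) :=
| Node of rule T & sequent E T L & seq (tree E T L).

Definition concl E T L (t : tree E T L) : sequent E T L :=
  let: Node _ s _ := t in s.

Section TreeMap.
Variables (E T L E' T' L' : Type) (fE : E -> E') (fT : T -> T') (fL : L -> L').

Definition rule_map (r : rule T) : rule T' :=
  match r with
  | RVar => RVar | RMany => RMany | RApp => RApp | RAbsI => RAbsI
  | RAbsK A => RAbsK (fT A)
  end.

Definition sequent_map (s : sequent E T L) : sequent E' T' L' :=
  Sequent (fE (ctx s)) (subject s)
    match assigned s with inl A => inl (fT A) | inr l => inr (fL l) end.

Fixpoint tree_map (t : tree E T L) : tree E' T' L' :=
  let: Node r s ts := t in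
  Node (rule_map r) (sequent_map s) [seq tree_map u | u <- ts].

End TreeMap.

Definition pvar := nat.

Inductive pretype :=
| PVar of pvar
| PArr of seq pretype & pretype.

Fixpoint pretype_code (A : pretype) : GenTree.tree pvar :=
  match A with
  | PVar a => GenTree.Leaf a
  | PArr s B => GenTree.Node 0 (pretype_code B :: map pretype_code s)
  end.

Fixpoint pretype_decode (t : GenTree.tree pvar) : pretype :=
  match t with
  | GenTree.Leaf a => PVar a
  | GenTree.Node _ ts =>
      match map pretype_decode ts with
      | [::] => PVar 0
      | B :: s => PArr s B
      end
  end.

Lemma pretype_nested_ind (P : pretype -> Prop) :
  (forall a, P (PVar a)) ->
  (forall s B, foldr (fun A => and (P A)) True s -> P B -> P (PArr s B)) ->
  forall A, P A.
Proof.
move=> Pvar Parr; fix IH 1 => -[a|s B]; first exact: Pvar.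
by apply: Parr; [elim: s => [|A s IHs] /=; split | ].
Qed.

Lemma pretype_codeK : cancel pretype_code pretype_decode.
Proof.
elim/pretype_nested_ind => //= s B IHs IHB; rewrite IHB; congr PArr.
by elim: s IHs => //= A s IH [-> /IH ->].
Qed.

HB.instance Definition _ := Countable.copy pretype (can_type pretype_codeK).

Definition penv := env ([::] : seq pretype).
Definition ptree := tree penv pretype (seq pretype).

Definition pcat : penv -> penv -> penv := env_op cat.

Fixpoint occurs (a : pvar) (A : pretype) : bool :=
  match A with
  | PVar b => a == b
  | PArr s B => has (occurs a) s || occurs a B
  end.

Definition occurs_penv (a : pvar) (G : penv) : bool :=
  has (fun x => has (occurs a) (G x)) (finsupp G).

Definition occurs_rule (a : pvar) (r : rule pretype) : bool :=
  if r is RAbsK A then occurs a A else false.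

Definition occurs_sequent (a : pvar)
    (s : sequent penv pretype (seq pretype)) : bool :=
  occurs_penv a (ctx s) ||
  match assigned s with inl A => occurs a A | inr l => has (occurs a) l end.

Fixpoint occurs_ptree (a : pvar) (t : ptree) : bool :=
  let: Node r s ts := t in
  [|| occurs_rule a r, occurs_sequent a s | has (occurs_ptree a) ts].

Definition fresh_for (a : pvar) (t : ptree) : Prop := ~~ occurs_ptree a t.

Definition disjoint_ptrees (t u : ptree) : Prop :=
  forall a, ~~ (occurs_ptree a t && occurs_ptree a u).

Fixpoint psubst (psi : pvar -> pretype) (A : pretype) : pretype :=
  match A with
  | PVar a => psi a
  | PArr s B => PArr (map (psubst psi) s) (psubst psi B)
  end.

Definition psubst_seq psi : seq pretype -> seq pretype := map (psubst psi).
Definition psubst_env psi : penv -> penv := env_map [::] (psubst_seq psi).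
Definition psubst_tree psi : ptree -> ptree :=
  tree_map (psubst_env psi) (psubst psi) (psubst_seq psi).

Inductive eqn :=
| TyEq of pretype & pretype
| ListEq of seq pretype & seq pretype.

Definition eqn_code (e : eqn) :
    (pretype * pretype) + (seq pretype * seq pretype) :=
  match e with TyEq A B => inl (A, B) | ListEq s t => inr (s, t) end.

Definition eqn_decode
    (e : (pretype * pretype) + (seq pretype * seq pretype)) : eqn :=
  match e with inl p => TyEq p.1 p.2 | inr p => ListEq p.1 p.2 end.

Lemma eqn_codeK : cancel eqn_code eqn_decode. Proof. by case. Qed.

HB.instance Definition _ := Countable.copy eqn (can_type eqn_codeK).

(* [pseudo t E]: (t, E) is a strong pseudo-derivation, E being its E_Pi. *)
Inductive pseudo : ptree -> {fset eqn} -> Prop :=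
| pseudo_var x a :
    pseudo (Node RVar (Sequent (env1 [::] x [:: PVar a]) (TVar x)
                               (inl (PVar a))) [::])
           fset0
| pseudo_many n M (t : nat -> ptree) (E : nat -> {fset eqn})
      (G : nat -> penv) (a : nat -> pvar) :
    0 < n ->
    (forall i, i < n -> pseudo (t i) (E i)) ->
    (forall i, i < n -> concl (t i) = Sequent (G i) M (inl (PVar (a i)))) ->
    (forall i j, i < n -> j < n -> i <> j -> disjoint_ptrees (t i) (t j)) ->
    pseudo (Node RMany (Sequent (\big[pcat/env0 [::]]_(i < n) G i) M
                                (inr (mkseq (fun i => PVar (a i)) n)))
                 (mkseq t n))
           (\big[fsetU/fset0]_(i < n) E i)
| pseudo_app M N t1 t2 E1 E2 (G D : penv) a (b : seq pvar) c :
    pseudo t1 E1 -> concl t1 = Sequent G M (inl (PVar a)) ->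
    pseudo t2 E2 -> concl t2 = Sequent D N (inr (map PVar b)) ->
    disjoint_ptrees t1 t2 ->
    fresh_for c t1 -> fresh_for c t2 ->
    pseudo (Node RApp (Sequent (pcat G D) (TApp M N) (inl (PVar c)))
                 [:: t1; t2])
           (E1 `|` E2 `|` [fset TyEq (PVar a) (PArr (map PVar b) (PVar c))])
| pseudo_absI x M t E (G : penv) s a b :
    pseudo t E -> x \notin finsupp G ->
    concl t = Sequent (env_ext G x s) M (inl (PVar a)) -> s <> [::] ->
    fresh_for b t ->
    pseudo (Node RAbsI (Sequent G (TLam x M) (inl (PVar b))) [:: t])
           (E `|` [fset TyEq (PVar b) (PArr s (PVar a))])
| pseudo_absK x M t E (G : penv) a b c :
    pseudo t E -> concl t = Sequent G M (inl (PVar a)) ->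
    x \notin finsupp G ->
    fresh_for b t -> fresh_for c t -> b <> c ->
    pseudo (Node (RAbsK (PVar b)) (Sequent G (TLam x M) (inl (PVar c)))
                 [:: t])
           (E `|` [fset TyEq (PVar c) (PArr [:: PVar b] (PVar a))]).

Definition is_many (t : ptree) : bool :=
  if t is Node RMany _ _ then true else false.

Fixpoint unary_many (t : ptree) : bool :=
  let: Node _ _ ts := t in
  (is_many t ==> (size ts == 1)) && all unary_many ts.

(* [PDmin M t E]: (t, E) is PD_min(M), for some choice of its variables. *)
Definition PDmin (M : term) (t : ptree) (E : {fset eqn}) : Prop :=
  [/\ pseudo t E, unary_many t &
      exists (G : penv) (a : pvar), concl t = Sequent G M (inl (PVar a))].

Inductive subtree (u : ptree) : ptree -> Prop :=
| subtree_refl : subtree u u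
| subtree_child r s ts1 t ts2 :
    subtree u t -> subtree u (Node r s (ts1 ++ t :: ts2)).

(* [graft u u' t t']: t' is t with one occurrence of the subtree u replaced
   by u'. The environments below that occurrence are left open here: they are
   determined by requiring t' to be a pseudo-derivation. *)
Inductive graft (u u' : ptree) : ptree -> ptree -> Prop :=
| graft_here : graft u u' u u'
| graft_child r G G' M A ts1 t t' ts2 :
    graft u u' t t' ->
    graft u u' (Node r (Sequent G M A) (ts1 ++ t :: ts2))
               (Node r (Sequent G' M A) (ts1 ++ t' :: ts2)).

(* [Expand s n t t' E']: Exp(s, n, t) is (t', E'). The first [size s] copies
   keep the variables listed in s as the types of their roots; all the other
   variables of the copies are fresh. *)
Inductive Expand (s : seq pretype) (n : nat) (t : ptree) :
    ptree -> {fset eqn} -> Prop :=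
| Expand_many G G' N ts (m := size s) (a : nat -> pvar) (c : nat -> ptree)
      t' E' :
    s <> [::] -> 0 < n ->
    s = mkseq (fun i => PVar (a i)) m ->
    (forall i, i < m + n -> exists E, PDmin N (c i) E) ->
    (forall i, i < m + n -> assigned (concl (c i)) = inl (PVar (a i))) ->
    (forall i j, i < m + n -> j < m + n -> i <> j ->
       disjoint_ptrees (c i) (c j)) ->
    (forall i b, i < m + n -> occurs_ptree b (c i) ->
       fresh_for b t \/ (i < m /\ b = a i)) ->
    graft (Node RMany (Sequent G N (inr s)) ts)
          (Node RMany
             (Sequent G' N (inr (mkseq (fun i => PVar (a i)) (m + n))))
             (mkseq c (m + n)))
          t t' ->
    pseudo t' E' ->
    Expand s n t t' E'
| Expand_id E :
    s <> [::] -> 0 < n ->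
    (forall G N ts, ~ subtree (Node RMany (Sequent G N (inr s)) ts) t) ->
    pseudo t E ->
    Expand s n t t E.

Definition single_subst (a : pvar) (A : pretype) (b : pvar) : pretype :=
  if b == a then A else PVar b.

Definition occurs_eqn (a : pvar) (e : eqn) : bool :=
  match e with
  | TyEq A B => occurs a A || occurs a B
  | ListEq s t => has (occurs a) s || has (occurs a) t
  end.

Definition subst_eqn (a : pvar) (A : pretype) (e : eqn) : eqn :=
  match e with
  | TyEq B C => TyEq (psubst (single_subst a A) B) (psubst (single_subst a A) C)
  | ListEq s t => ListEq (psubst_seq (single_subst a A) s)
                         (psubst_seq (single_subst a A) t)
  end.

(* Occurrences outside lists: in s1 -> ... -> sk -> b, only that of b. *)
Fixpoint occurs_out (a : pvar) (A : pretype) : bool :=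
  match A with PVar b => a == b | PArr _ B => occurs_out a B end.

Fixpoint subst_out (a : pvar) (A B : pretype) : pretype :=
  match B with
  | PVar b => single_subst a A b
  | PArr s C => PArr s (subst_out a A C)
  end.

Definition occurs_out_eqn (a : pvar) (e : eqn) : bool :=
  match e with
  | TyEq A B => occurs_out a A || occurs_out a B
  | ListEq _ _ => false
  end.

Definition subst_out_eqn (a : pvar) (A : pretype) (e : eqn) : eqn :=
  match e with
  | TyEq B C => TyEq (subst_out a A B) (subst_out a A C)
  | ListEq s t => ListEq s t
  end.

Section UnificationStep.
Variables (occ : pvar -> eqn -> bool) (sub : pvar -> pretype -> eqn -> eqn).

Inductive unif_step : {fset eqn} -> {fset eqn} -> Prop :=
| step_erase A S :
    TyEq A A \notin S ->
    unif_step (TyEq A A |` S) S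
| step_swap s A a S :
    TyEq (PArr s A) (PVar a) \notin S ->
    unif_step (TyEq (PArr s A) (PVar a) |` S)
              (TyEq (PVar a) (PArr s A) |` S)
| step_arrow s A t B S :
    TyEq (PArr s A) (PArr t B) \notin S ->
    unif_step (TyEq (PArr s A) (PArr t B) |` S)
              (ListEq s t |` (TyEq A B |` S))
| step_list s t S :
    size s = size t -> ListEq s t \notin S ->
    unif_step (ListEq s t |` S)
              ([fset TyEq p.1 p.2 | p in zip s t] `|` S)
| step_subs a A S :
    TyEq (PVar a) A \notin S -> ~~ occurs a A ->
    (exists2 e, e \in S & occ a e) ->
    unif_step (TyEq (PVar a) A |` S)
              (TyEq (PVar a) A |` [fset sub a A e | e in S]).

(* Normal forms are unique only up to the choice of variable names, hence a
   relation rather than a function. *)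
Definition unif_nf (E E' : {fset eqn}) : Prop :=
  clos_refl_trans _ unif_step E E' /\ forall E'', ~ unif_step E' E''.

End UnificationStep.

Definition nf_u := unif_nf occurs_eqn subst_eqn.
Definition nf_o := unif_nf occurs_out_eqn subst_out_eqn.

Definition blocked (E : {fset eqn}) : Prop :=
  exists s t, ListEq s t \in E /\ size s <> size t.

Definition solved (E : {fset eqn}) : Prop :=
  [/\ forall e, e \in E -> exists a B, e = TyEq (PVar a) B,
      forall a B B', TyEq (PVar a) B \in E -> TyEq (PVar a) B' \in E -> B = B' &
      forall a A b B, TyEq (PVar a) A \in E -> TyEq (PVar b) B \in E ->
        ~~ occurs a B].

(* Meaningful when E is in solved form. *)
Definition mgu (E : {fset eqn}) (a : pvar) : pretype :=
  head (PVar a)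
    (pmap (fun e => if e is TyEq A B then
                      if A == PVar a then Some B else None
                    else None) (enum_fset E)).

(* [infer_loop t E t' E']: the loop, entered with (t, E), exits with (t', E'). *)
Inductive infer_loop :
    ptree -> {fset eqn} -> ptree -> {fset eqn} -> Prop :=
| loop_exit t E : ~ blocked E -> infer_loop t E t E
| loop_right t E s1 s2 t1 E1 E1' t' E' :
    ListEq s1 s2 \in E -> size s2 < size s1 ->
    Expand s2 (size s1 - size s2) t t1 E1 -> nf_o E1 E1' ->
    infer_loop t1 E1' t' E' -> infer_loop t E t' E'
| loop_left t E s1 s2 t1 E1 E1' t' E' :
    ListEq s1 s2 \in E -> size s1 < size s2 ->
    Expand s1 (size s2 - size s1) t t1 E1 -> nf_o E1 E1' ->
    infer_loop t1 E1' t' E' -> infer_loop t E t' E'.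

(* [InferStrong M t psi]: some run of InferStrong(M) returns (t, psi). *)
Inductive InferStrong (M : term) : ptree -> (pvar -> pretype) -> Prop :=
| InferStrong_returns t0 E0 E1 t E Eu :
    PDmin M t0 E0 -> nf_o E0 E1 -> infer_loop t0 E1 t E ->
    nf_u E Eu -> solved Eu ->
    InferStrong M t (mgu Eu).

Definition tvar := nat.

Definition pretype_le (A B : pretype) : bool := choice.pickle A <= choice.pickle B.

(* Types are the syntax trees a | mu -> A with mu a finite multiset. They are
   represented by the pre-types all of whose lists are sorted for an arbitrary
   total order, so that multiset equality of types is Leibniz equality;
   [ty_nested_ind], [ty_arr_inj] and [ty_var_arr] state that [ty] is freely
   generated by [ty_var] and [ty_arr]. *)
Fixpoint canonical (A : pretype) : bool :=
  match A with
  | PVar _ => true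
  | PArr s B => [&& sorted pretype_le s, all canonical s & canonical B]
  end.

Record ty := Ty { ty_val : pretype; ty_valP : canonical ty_val }.

HB.instance Definition _ := [isSub for ty_val].
HB.instance Definition _ := [Countable of ty by <:].

Definition ty_var (a : tvar) : ty := @Ty (PVar a) isT.

Fact pretype_le_total : total pretype_le.
Proof. by move=> A B; apply: leq_total. Qed.

Fact pretype_le_trans : transitive pretype_le.
Proof. by move=> A B C; apply: leq_trans. Qed.

Fact pretype_le_anti : antisymmetric pretype_le.
Proof.
by move=> A B; rewrite -eqn_leq => /eqP; apply: (pcan_inj choice.pickleK).
Qed.

Fact ty_arr_subproof (mu : {mset ty}) (A : ty) :
  canonical (PArr (sort pretype_le (map ty_val mu)) (ty_val A)).
Proof.
rewrite /= sort_sorted ?all_sort; last exact: pretype_le_total.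
by rewrite all_map ty_valP andbT; apply/allP => B _ /=; apply: ty_valP.
Qed.

Definition ty_arr (mu : {mset ty}) (A : ty) : ty := Ty (ty_arr_subproof mu A).

Lemma ty_var_arr a mu A : ty_var a <> ty_arr mu A.
Proof. by move/(congr1 ty_val). Qed.

Lemma ty_var_inj : injective ty_var.
Proof. by move=> a b /(congr1 ty_val) []. Qed.

Lemma ty_arr_inj mu A nu B : ty_arr mu A = ty_arr nu B -> mu = nu /\ A = B.
Proof.
move=> /(congr1 ty_val) /= [emunu /val_inj eAB]; split=> //.
rewrite -[mu]seq_mset_id -[nu]seq_mset_id; apply/eq_seq_msetP.
apply: (perm_map_inj val_inj); rewrite -(perm_sort pretype_le) /= emunu.
by rewrite perm_sym -(perm_sort pretype_le).
Qed.

Lemma ty_nested_ind (P : ty -> Prop) :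
  (forall a, P (ty_var a)) ->
  (forall (mu : {mset ty}) A, {in mu, forall B, P B} -> P A -> P (ty_arr mu A)) ->
  forall A, P A.
Proof.
move=> Pvar Parr [A cA]; elim/pretype_nested_ind: A cA => [a|s B IHs IHB] cA.
  by rewrite (_ : Ty _ = ty_var a) //; apply: val_inj.
have /and3P[ss cs cB] := cA.
have [l es Pl] : exists2 l, s = map ty_val l & {in l, forall C, P C}.
  elim: s IHs cs {cA ss} => [|C s IH] /= => [_ _|[PC Ps] /andP[cC cs]].
    by exists [::].
  have [l -> Pl] := IH Ps cs; exists (Ty cC :: l) => // D.
  by rewrite inE => /orP[/eqP->|/Pl].
rewrite (_ : Ty cA = ty_arr (seq_mset l) (Ty cB)).
  apply: Parr => // D; rewrite (perm_mem (perm_eq_seq_mset l)); exact: Pl.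
apply: val_inj; congr PArr => /=.
apply: (sorted_eq pretype_le_trans pretype_le_anti) => //.
  by apply: sort_sorted; apply: pretype_le_total.
by rewrite perm_sym perm_sort es perm_map // perm_eq_seq_mset.
Qed.

(* The set T_s: all multisets are nonempty. *)
Inductive in_Ts : ty -> Prop :=
| in_Ts_var a : in_Ts (ty_var a)
| in_Ts_arr (mu : {mset ty}) A :
    mu <> mset0 -> (forall B, B \in mu -> in_Ts B) -> in_Ts A ->
    in_Ts (ty_arr mu A).

Definition tenv := env (mset0 : {mset ty}).
Definition ttree := tree tenv ty {mset ty}.

Definition tsum : tenv -> tenv -> tenv := env_op (@msetD ty).

(* Types enter a derivation through (var) and (abs-K) only, so it is enough to
   ask for membership in T_s there. *)
Inductive derivation : ttree -> Prop :=
| der_var x A :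
    in_Ts A ->
    derivation (Node RVar (Sequent (env1 mset0 x [mset A]) (TVar x) (inl A))
                     [::])
| der_many n M (t : nat -> ttree) (G : nat -> tenv) (A : nat -> ty) :
    0 < n ->
    (forall i, i < n -> derivation (t i)) ->
    (forall i, i < n -> concl (t i) = Sequent (G i) M (inl (A i))) ->
    derivation (Node RMany (Sequent (\big[tsum/env0 mset0]_(i < n) G i) M
                                    (inr (seq_mset (mkseq A n))))
                     (mkseq t n))
| der_app M N t1 t2 (G D : tenv) mu A :
    derivation t1 -> concl t1 = Sequent G M (inl (ty_arr mu A)) ->
    derivation t2 -> concl t2 = Sequent D N (inr mu) ->
    derivation (Node RApp (Sequent (tsum G D) (TApp M N) (inl A)) [:: t1; t2])
| der_absI x M t (G : tenv) mu A :
    derivation t -> x \notin finsupp G ->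
    concl t = Sequent (env_ext G x mu) M (inl A) -> mu <> mset0 ->
    derivation (Node RAbsI (Sequent G (TLam x M) (inl (ty_arr mu A))) [:: t])
| der_absK x M t (G : tenv) A B :
    derivation t -> concl t = Sequent G M (inl B) ->
    x \notin finsupp G -> in_Ts A ->
    derivation (Node (RAbsK A)
                     (Sequent G (TLam x M) (inl (ty_arr [mset A] B))) [:: t]).

Section ToTypes.
Variable v : pvar -> tvar.

Fixpoint m_ty (A : pretype) : ty :=
  match A with
  | PVar a => ty_var (v a)
  | PArr s B => ty_arr (seq_mset (map m_ty s)) (m_ty B)
  end.

Definition m_seq (s : seq pretype) : {mset ty} := seq_mset (map m_ty s).
Definition m_env : penv -> tenv := env_map mset0 m_seq.
Definition m_tree : ptree -> ttree := tree_map m_env m_ty m_seq.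

End ToTypes.

(* Main.v *)
Require Import Defs.
From Stdlib Require Import Relation_Operators.
From mathcomp Require Import all_boot.
From mathcomp Require Import finmap multiset.

(** Each unification rule, read backwards, preserves unifiers, and Exp
    recomputes the equations of the pseudo-derivation it returns. Hence the
    most general unifier of the final solved form solves the equations
    [E_Pi] of the returned tree, and under a solution of [E_Pi] the rules of
    pseudo-derivations become those of the type system. The types introduced
    by (var) and (abs-K) lie in [T_s] because all lists in [E_Pi] are nonempty,
    and unification never creates an empty list. *)

Set Implicit Arguments.
Unset Strict Implicit.
Unset Printing Implicit Defensive.

Local Open Scope mset_scope.
Local Open Scope fset_scope.

(** * Environments, pointwise *)

Lemma env_extE (L : eqType) (d : L) (G : env d) x l y : env_ext G x l y = if y == x then l else G y.
Proof. by rewrite /env_ext fsfun_withE. Qed.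

(** Outside both supports the left side is the default [d], so [op d d = d] makes the equation hold
    at every [x]. *)
Lemma env_opE (L : eqType) (d : L) (op : L -> L -> L) (G D : env d) x :
  op d d = d -> env_op op G D x = op (G x) (D x).
Proof.
move=> opd; rewrite fsfunE in_fsetU !mem_finsupp.
by case: (G x =P d) => [->|] //; case: (D x =P d) => [->|].
Qed.

Section EnvMap.
Variables (L L' : eqType) (d : L) (d' : L').

Lemma env_mapE (f : L -> L') (G : env d) x :
  f d = d' -> env_map d' f G x = f (G x).
Proof. by move=> fd; rewrite fsfunE mem_finsupp; case: (G x =P d) => [->|]. Qed.

Lemma env_map_ext (f : L -> L') (G : env d) x l : f d = d' ->
  env_map d' f (env_ext G x l) = env_ext (env_map d' f G) x (f l).
Proof.
move=> fd; apply/fsfunP => y.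
by rewrite env_extE !env_mapE // env_extE; case: ifP.
Qed.

Lemma env_map0 (f : L -> L') : f d = d' -> env_map d' f (env0 d) = env0 d'.
Proof. by move=> fd; apply/fsfunP => y; rewrite env_mapE // !fsfun0E. Qed.

Lemma env_map1 (f : L -> L') x l : f d = d' ->
  env_map d' f (env1 d x l) = env1 d' x (f l).
Proof. by move=> fd; rewrite /env1 env_map_ext // env_map0. Qed.

Lemma env_map_op (op : L -> L -> L) (op' : L' -> L' -> L') (f : L -> L') :
  f d = d' -> op d d = d -> {morph f : k l / op k l >-> op' k l} ->
  {morph env_map d' f : G D / @env_op _ d op G D >-> @env_op _ d' op' G D}.
Proof.
move=> fd opd fM G D; apply/fsfunP => y.
(* The last rewrites derive [op' d' d' = d'], the side condition of [env_opE] on the target side. *)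
by rewrite env_mapE // !env_opE ?env_mapE // -fd -fM opd.
Qed.

Lemma notin_finsupp_env_map (f : L -> L') (G : env d) x :
  f d = d' -> x \notin finsupp G -> x \notin finsupp (env_map d' f G).
Proof.
move=> fd; rewrite !mem_finsupp env_mapE // !negbK => /eqP ->.
by rewrite fd.
Qed.

End EnvMap.

(** * Multisets obtained from lists *)

Lemma seq_mset_cat (K : choiceType) (s t : seq K) :
  seq_mset (s ++ t) = seq_mset s `+` seq_mset t.
Proof. by apply/msetP => x; rewrite msetE2 !mset_seqE count_cat. Qed.

Lemma seq_mset1 (K : choiceType) (x : K) : seq_mset [:: x] = [mset x].
Proof. by apply/msetP => y; rewrite mset_seqE msetnE /= addn0 eq_sym; case: eqP. Qed.

Lemma seq_mset_nil (K : choiceType) : seq_mset [::] = mset0 :> {mset K}.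
Proof. by apply/msetP => y; rewrite mset_seqE mset0E. Qed.

Lemma mem_seq_mset (K : choiceType) (s : seq K) : seq_mset s =i s.
Proof. exact: perm_mem (perm_eq_seq_mset s). Qed.

Lemma seq_mset_neq0 (K : choiceType) (s : seq K) :
  s != [::] -> seq_mset s <> mset0.
Proof.
by case: s => // x s _ s0; have := mem_seq_mset (x :: s) x; rewrite s0 in_mset0 mem_head.
Qed.

Lemma map_neq_nil (A B : eqType) (f : A -> B) s :
  (map f s != [::]) = (s != [::]).
Proof. by case: s. Qed.

(** * Strict pre-types *)

Lemma pretype_mem_ind (P : pretype -> Prop) :
  (forall a, P (PVar a)) ->
  (forall s B, {in s, forall A, P A} -> P B -> P (PArr s B)) ->
  forall A, P A.
Proof.
move=> Pvar Parr; elim/pretype_nested_ind => // s B IHs IHB; apply: Parr => //.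
elim: s IHs => //= A s IH [PA /IH Ps] C; rewrite inE => /orP[/eqP->//|]; exact: Ps.
Qed.

(** The pre-type counterpart of [in_Ts]. *)
Fixpoint strict (A : pretype) : bool :=
  match A with
  | PVar _ => true
  | PArr s B => [&& s != [::], all strict s & strict B]
  end.

Definition strict_eqn (e : Defs.eqn) : bool :=
  match e with
  | TyEq A B => strict A && strict B
  | ListEq s t => all strict s && all strict t
  end.

Definition strict_eqns (E : {fset Defs.eqn}) : Prop := {in E, forall e, strict_eqn e}.

Lemma strict_psubst psi A :
  (forall a, strict (psi a)) -> strict A -> strict (psubst psi A).
Proof.
move=> psiS; elim/pretype_mem_ind: A => //= s B IHs IHB /and3P[s0 sS BS].
rewrite map_neq_nil s0 IHB // andbT all_map; apply/allP => C sC /=.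
by rewrite IHs // (allP sS).
Qed.

(** Supplies the [in_Ts] premises of [der_var] and [der_absK]. *)
Lemma strict_m_ty v A : strict A -> in_Ts (m_ty v A).
Proof.
elim/pretype_mem_ind: A => [a _|s B IHs IHB /= /and3P[s0 sS BS]].
  exact: in_Ts_var.
apply: in_Ts_arr (IHB BS); first by apply: seq_mset_neq0; rewrite map_neq_nil.
move=> C; rewrite mem_seq_mset => /mapP[A sA ->].
by apply: IHs => //; apply: (allP sS).
Qed.

(** * Unifiers, and what unification steps preserve *)

Definition unifies_eqn (psi : pvar -> pretype) (e : Defs.eqn) : Prop :=
  match e with
  | TyEq A B => psubst psi A = psubst psi B
  | ListEq s t => psubst_seq psi s = psubst_seq psi t
  end.

Definition unifies psi (E : {fset Defs.eqn}) : Prop :=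
  {in E, forall e, unifies_eqn psi e}.

Section UnificationSteps.
Variables (occ : pvar -> Defs.eqn -> bool) (sub : pvar -> pretype -> Defs.eqn -> Defs.eqn).
Hypothesis sub_strict : forall a A e,
  strict A -> strict_eqn e -> strict_eqn (sub a A e).
Hypothesis sub_unifies : forall psi a A, psi a = psubst psi A ->
  forall e, unifies_eqn psi (sub a A e) -> unifies_eqn psi e.

(** Steps decompose arrows and lists or substitute a strict pre-type, so an arrow never acquires an
    empty list. Keeping [occ] and [sub] abstract lets one proof serve both [nf_u] and [nf_o]. *)
Lemma unif_step_strict E E' :
  unif_step occ sub E E' -> strict_eqns E -> strict_eqns E'.
Proof.
have in1 e (S : {fset Defs.eqn}) : e \in e |` S by rewrite fset1U1.
case=> [A S _|s A a S _|s A t B S _|s t S st _|a A S _ _ _] ES e.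
- by move=> Se; apply: ES; rewrite fset1Ur.
- have /andP[h _] := ES _ (in1 _ _).
  by rewrite in_fset1U => /orP[/eqP->//|Se]; apply: ES; rewrite fset1Ur.
- have /andP[/and3P[_ sS AS] /and3P[_ tS BS]] := ES _ (in1 _ _).
  rewrite !in_fset1U => /or3P[/eqP->|/eqP->|Se]; try exact/andP.
  by apply: ES; rewrite fset1Ur.
- have /andP[/allP sS /allP tS] := ES _ (in1 _ _).
  rewrite in_fsetU => /orP[/imfsetP[[A B] /= stAB ->] /=|Se].
    have := map_f fst stAB; rewrite [map _ _]unzip1_zip ?st // => /sS ->.
    by have := map_f snd stAB; rewrite [map _ _]unzip2_zip ?st // => /tS ->.
  by apply: ES; rewrite fset1Ur.
- have AS := ES _ (in1 _ _).
  rewrite in_fset1U => /orP[/eqP->//|/imfsetP[f /= Sf ->]].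
  by apply: sub_strict => //; apply: ES; rewrite fset1Ur.
Qed.

(** This direction carries the final unifier back to the initial equations. After [step_subs] the
    equation [a = A] is still present, which gives the premise of [sub_unifies]. *)
Lemma unif_step_unifies psi E E' :
  unif_step occ sub E E' -> unifies psi E' -> unifies psi E.
Proof.
case=> [A S _|s A a S _|s A t B S _|s t S st _|a A S _ _ _] U e;
  rewrite in_fset1U => /orP[/eqP->|Se].
(* The goals come in pairs, one pair per rule: the equation acted on, then an equation of the
   rest. *)
- by [].
- exact: U.
- by have /= -> := U _ (fset1U1 _ _).
- by apply: U; rewrite fset1Ur.
- have /= := U _ (fset1U1 _ _); rewrite /psubst_seq => ->.
  by have /= -> // : unifies_eqn psi (TyEq A B) by apply: U; rewrite fset1Ur ?fset1U1.
- by apply: U; rewrite !fset1Ur.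
- have {}U A B : (A, B) \in zip s t -> psubst psi A = psubst psi B.
    move=> stAB; have := U (TyEq A B); apply; rewrite in_fsetU.
    by apply/orP; left; apply/imfsetP; exists (A, B).
  rewrite /= /psubst_seq; elim: s t st U => [|A s IH] [|B t] //= [st] U.
  rewrite (U A B) ?mem_head // (IH t) // => C D CD.
  by apply: U; rewrite inE CD orbT.
- by apply: U; rewrite in_fsetU Se orbT.
- exact: U (fset1U1 _ _).
- apply: (@sub_unifies psi a A _ e); first exact: U (fset1U1 _ _).
  by apply: U; rewrite fset1Ur // in_imfset.
Qed.

Lemma unif_nf_strict E E' : unif_nf occ sub E E' -> strict_eqns E -> strict_eqns E'.
Proof.
by case=> + _; elim=> [? ?|//|? ? ? _ IH1 _ IH2 /IH1/IH2//]; apply: unif_step_strict.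
Qed.

Lemma unif_nf_unifies psi E E' : unif_nf occ sub E E' -> unifies psi E' -> unifies psi E.
Proof.
by case=> + _; elim=> [? ?|//|? ? ? _ IH1 _ IH2 /IH2/IH1//]; apply: unif_step_unifies.
Qed.

End UnificationSteps.

Lemma strict_single_subst a A b : strict A -> strict (single_subst a A b).
Proof. by rewrite /single_subst; case: ifP. Qed.

Lemma subst_eqn_strict a A e : strict A -> strict_eqn e -> strict_eqn (subst_eqn a A e).
Proof.
move=> AS.
have sS B : strict B -> strict (psubst (single_subst a A) B).
  by apply: strict_psubst => b; apply: strict_single_subst.
case: e => [B C|s t] /= /andP[hs ht]; first by rewrite !sS.
by rewrite !all_map; apply/andP; split; apply/allP => B Bs /=; apply: sS;
  [apply: (allP hs) | apply: (allP ht)].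
Qed.

(** [subst_out] follows the targets of arrows and leaves lists untouched, so plain induction on
    [pretype] suffices. *)
Lemma subst_out_eqn_strict a A e :
  strict A -> strict_eqn e -> strict_eqn (subst_out_eqn a A e).
Proof.
move=> AS.
have sS B : strict B -> strict (subst_out a A B).
  elim: B => /= [b _|s B IH /and3P[-> -> /IH->//]]; exact: strict_single_subst.
by case: e => //= B C /andP[/sS-> /sS->].
Qed.

Section SubstUnifies.
Variables (psi : pvar -> pretype) (a : pvar) (A : pretype).
Hypothesis psia : psi a = psubst psi A.

(** Since [psi] already identifies [a] with [A], it absorbs the replacement, whether all occurrences
    or only those outside lists are replaced. *)
Lemma psubst_single_subst b : psubst psi (single_subst a A b) = psi b.
Proof. by rewrite /single_subst; case: eqP => [->|]. Qed.

Lemma psubst_psubst_single B :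
  psubst psi (psubst (single_subst a A) B) = psubst psi B.
Proof.
elim/pretype_mem_ind: B => [b|s B IHs IHB] /=; first exact: psubst_single_subst.
by rewrite IHB -map_comp; congr PArr; apply/eq_in_map.
Qed.

Lemma psubst_subst_out B : psubst psi (subst_out a A B) = psubst psi B.
Proof.
elim: B => [b|s B IHB] /=; first exact: psubst_single_subst.
by rewrite IHB.
Qed.

Lemma subst_eqn_unifies e : unifies_eqn psi (subst_eqn a A e) -> unifies_eqn psi e.
Proof.
case: e => [B C|s t] /=; first by rewrite !psubst_psubst_single.
by rewrite /psubst_seq -!map_comp !(eq_map psubst_psubst_single).
Qed.

Lemma subst_out_eqn_unifies e :
  unifies_eqn psi (subst_out_eqn a A e) -> unifies_eqn psi e.
Proof. by case: e => [B C|s t] //=; rewrite !psubst_subst_out. Qed.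

End SubstUnifies.

(** * The most general unifier of a solved form *)

Lemma psubst_id psi A : (forall a, occurs a A -> psi a = PVar a) -> psubst psi A = A.
Proof.
elim/pretype_mem_ind: A => [a|s B IHs IHB] /= idA; first by rewrite idA ?eqxx.
rewrite IHB => [|a aB]; last by rewrite idA // aB orbT.
congr PArr; rewrite -[RHS]map_id; apply/eq_in_map => A sA.
apply: IHs => // a aA; rewrite idA //; apply/orP; left; apply/hasP.
by exists A.
Qed.

(** Forgets which right-hand side the enumeration puts first; that there is only one enters in
    [mgu_unifies]. *)
Variant mgu_spec (E : {fset Defs.eqn}) a : pretype -> Prop :=
| MguIn B of TyEq (PVar a) B \in E : mgu_spec E a B
| MguNotin of (forall B, TyEq (PVar a) B \notin E) : mgu_spec E a (PVar a).

Lemma mguP E a : mgu_spec E a (mgu E a).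
Proof.
rewrite /mgu; set f := fun e => _.
(* The [pmap] in [mgu] collects exactly the right-hand sides of [a]. *)
have memf B : (B \in pmap f (enum_fset E)) = (TyEq (PVar a) B \in E).
  rewrite mem_pmap; apply/mapP/idP => [[[A C|//] EAC /=]|EaB]; last first.
    by exists (TyEq (PVar a) B); rewrite //= eqxx.
  by case: eqP => // <- [->].
case: (pmap f _) memf => [|B s] memf /=.
  by apply: MguNotin => B; rewrite -memf.
by apply: MguIn; rewrite -memf mem_head.
Qed.

(** No variable of a right-hand side [B] is itself a left-hand side, so [mgu E] fixes [B]. *)
Lemma mgu_unifies E : solved E -> unifies (mgu E) E.
Proof.
case=> EX Efun Eocc e Ee; have [a [B eE]] := EX e Ee; subst e.
have mguB : psubst (mgu E) B = B.
  apply: psubst_id => b bB; case: mguP => // C EbC.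
  by have := Eocc b C a B EbC Ee; rewrite bB.
rewrite /= mguB; case: mguP => [C EaC|/(_ B)]; first exact: Efun EaC Ee.
by rewrite Ee.
Qed.

Lemma mgu_strict E a : strict_eqns E -> strict (mgu E a).
Proof. by move=> ES; case: mguP => // B /ES /andP[]. Qed.

(** * Invariants of pseudo-derivations and of the loop *)

Lemma pseudo_assigned_seq t E s : pseudo t E ->
  assigned (concl t) = inr s -> s != [::] /\ all strict s.
Proof.
case=> //= n M t' E' G a n0 _ _ _ [<-]; split; first by case: n n0.
by rewrite all_map; apply/allP.
Qed.

(** Serves (abs-I) in [pseudo_strict], whose equation takes its list from the environment at [x];
    the entries all go back to variables introduced by (var). *)
Lemma pseudo_ctx_strict t E x : pseudo t E -> all strict (ctx (concl t) x).
Proof.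
move=> pt; elim: pt x => {t E}.
- by move=> x a y; rewrite /= env_extE fsfun0E; case: eqP.
- move=> n M t E G a n0 _ IH tG _ x /=.
  elim/big_ind: _ => [|D D' DS D'S|i _]; first by rewrite fsfun0E.
    by rewrite env_opE // all_cat DS.
  by have := IH i (ltn_ord i) x; rewrite tG.
- move=> M N t1 t2 E1 E2 G D a b c _ IH1 e1 _ IH2 e2 _ _ _ x /=.
  by rewrite env_opE // all_cat; move: (IH1 x) (IH2 x); rewrite e1 e2 /= => -> ->.
- move=> x M t E G s a b _ IH xG et _ _ y /=.
  (* At [y = x] the induction hypothesis speaks of [s], but there [G x] is empty. *)
  have := IH y; rewrite et /= env_extE; case: eqP => // -> _.
  by move: xG; rewrite mem_finsupp negbK => /eqP->.
- by move=> x M t E G a b c _ IH et _ _ _ _ y; have := IH y; rewrite et.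
Qed.

(** The list of each new arrow is nonempty: (app) takes it from a (many) rule, where [n >= 1],
    (abs-I) demands it, and (abs-K) uses a singleton. *)
Lemma pseudo_strict t E : pseudo t E -> strict_eqns E.
Proof.
elim=> {t E}.
- by move=> x a e; rewrite in_fset0.
- move=> n M t E G a _ _ IH _ _ e /bigfcupP[i _]; exact: IH.
- move=> M N t1 t2 E1 E2 G D a b c _ IH1 _ pt2 IH2 e2 _ _ _ e.
  rewrite !in_fsetU in_fset1 => /orP[/orP[/IH1|/IH2]//|/eqP->] /=.
  by have [|-> ->] := pseudo_assigned_seq (s := map PVar b) pt2; rewrite ?e2.
- move=> x M t E G s a b pt IH _ et s0 _ e.
  rewrite in_fsetU in_fset1 => /orP[/IH//|/eqP->] /=.
  have := pseudo_ctx_strict x pt; rewrite et /= env_extE eqxx => ->.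
  by rewrite !andbT; apply/eqP.
- move=> x M t E G a b c _ IH _ _ _ _ _ e.
  by rewrite in_fsetU in_fset1 => /orP[/IH//|/eqP->].
Qed.

(** Loop invariant: the current equations are a normal form of those of the current tree. [Expand]
    returns a pseudo-derivation with its own equations, so each pass establishes the invariant
    anew. *)
Lemma infer_loop_pseudo t E t' E' : infer_loop t E t' E' ->
  forall E0, pseudo t E0 -> nf_o E0 E ->
  exists2 E1, pseudo t' E1 & nf_o E1 E'.
Proof.
have ExpP s n t1 t2 E2 : Expand s n t1 t2 E2 -> pseudo t2 E2 by case.
elim=> {t E t' E'} [t E _ E0|t E s1 s2 t1 E1 E1' t' E' _ _ X1 nf1 _ IH E0 _ _|
                    t E s1 s2 t1 E1 E1' t' E' _ _ X1 nf1 _ IH E0 _ _].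
- by exists E0.
- exact: IH (ExpP _ _ _ _ _ X1) nf1.
- exact: IH (ExpP _ _ _ _ _ X1) nf1.
Qed.

(** Unifiers travel backwards from [Eu] through both normalizations, while strictness travels
    forwards to [Eu] and hence to its [mgu]. *)
Lemma InferStrong_pseudo M t psi : InferStrong M t psi ->
  exists E, [/\ pseudo t E, unifies psi E & forall a, strict (psi a)].
Proof.
case=> t0 E0 E1 t' E Eu [pt0 _ _] nf1 loop nfu Eus.
have [E2 pt' nf2] := infer_loop_pseudo loop pt0 nf1.
exists E2; split=> // [|a].
  apply: (unif_nf_unifies subst_out_eqn_unifies nf2).
  exact: (unif_nf_unifies subst_eqn_unifies nfu (mgu_unifies Eus)).
apply/mgu_strict/(unif_nf_strict subst_eqn_strict nfu).
exact: (unif_nf_strict subst_out_eqn_strict nf2 (pseudo_strict pt')).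
Qed.

(** * From pseudo-derivations to derivations *)

Lemma m_seq_nil v : m_seq v [::] = mset0. Proof. exact: seq_mset_nil. Qed.

Lemma m_seq_cat v : {morph m_seq v : s t / s ++ t >-> s `+` t}.
Proof. by move=> s t; rewrite /m_seq map_cat seq_mset_cat. Qed.

Lemma concl_tree_map E T L E' T' L' (fE : E -> E') (fT : T -> T') (fL : L -> L') t :
  concl (tree_map fE fT fL t) = sequent_map fE fT fL (concl t).
Proof. by case: t. Qed.

Section Soundness.
Variables (v : pvar -> tvar) (psi : pvar -> pretype).

Let ty_of A : ty := m_ty v (psubst psi A).
Let env_of (G : penv) : tenv := m_env v (psubst_env psi G).
Let mset_of s : {mset ty} := m_seq v (psubst_seq psi s).
Let tree_of t : ttree := m_tree v (psubst_tree psi t).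

Lemma env_of_ext G x s : env_of (env_ext G x s) = env_ext (env_of G) x (mset_of s).
Proof. by rewrite /env_of /m_env /psubst_env !env_map_ext // m_seq_nil. Qed.

Lemma env_of1 x s : env_of (env1 [::] x s) = env1 mset0 x (mset_of s).
Proof. by rewrite /env_of /m_env /psubst_env !env_map1 // m_seq_nil. Qed.

(** Two morphisms in a row: [psubst_env] keeps concatenation, [m_env] turns it into multiset
    union. *)
Lemma env_of_cat : {morph env_of : G D / pcat G D >-> tsum G D}.
Proof.
move=> G D; rewrite /env_of /psubst_env (@env_map_op _ _ _ _ cat cat) //; last first.
  by move=> s t; apply: map_cat.
rewrite /m_env (@env_map_op _ _ _ _ cat (@msetD ty)) //; first exact: m_seq_nil.
exact: m_seq_cat.
Qed.

Lemma notin_finsupp_env_of (G : penv) x :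
  x \notin finsupp G -> x \notin finsupp (env_of G).
Proof. by move=> xG; apply: notin_finsupp_env_map (m_seq_nil v) _; apply: notin_finsupp_env_map. Qed.

Lemma concl_tree_of t G M A : concl t = Sequent G M A ->
  concl (tree_of t) = Sequent (env_of G) M
    match A with inl B => inl (ty_of B) | inr s => inr (mset_of s) end.
Proof. by rewrite /tree_of /m_tree /psubst_tree !concl_tree_map => ->; case: A. Qed.

(** Rules match one to one. The equation added by a rule makes [psi] send the function's variable in
    (app), or the variable of the conclusion in the abstraction rules, to the required arrow. *)
Lemma pseudo_derivation t E : (forall a, strict (psi a)) ->
  pseudo t E -> unifies psi E -> derivation (tree_of t).
Proof.
move=> psiS; elim=> {t E}.
- move=> x a _; rewrite /tree_of /= /sequent_map /= -/(env_of _) env_of1 /mset_of /m_seq /= seq_mset1.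
  exact/der_var/strict_m_ty.
- move=> n M t E G a n0 _ IH tG _ U; rewrite /tree_of /= /sequent_map /= -/(env_of _).
  rewrite (big_morph env_of env_of_cat (id1 := env0 mset0)); last first.
    by rewrite /env_of /m_env /psubst_env !env_map0 // m_seq_nil.
  (* [mkseq] is a [map] over [iota], so fusing the maps yields the [mkseq] form that [der_many]
     expects. *)
  rewrite /m_seq /psubst_seq -!map_comp.
  apply: (@der_many n M (tree_of \o t) (env_of \o G) (fun i => ty_of (PVar (a i)))) => //.
    move=> i ltin; apply: IH => // e Ee; apply: U.
    by apply/bigfcupP; exists (Ordinal ltin); rewrite ?mem_index_enum.
  by move=> i /tG /concl_tree_of.
- move=> M N t1 t2 E1 E2 G D a b c _ IH1 e1 _ IH2 e2 _ _ _ U.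
  rewrite /tree_of /= /sequent_map /= -/(env_of _) env_of_cat.
  (* The argument premise fixes [mu] as the image of [map PVar b]. *)
  apply: der_app (concl_tree_of e2).
  + by apply: IH1 => e Ee; apply: U; rewrite !in_fsetU Ee.
  + rewrite (concl_tree_of e1) /ty_of.
    have /= -> // : unifies_eqn psi (TyEq (PVar a) (PArr (map PVar b) (PVar c))).
    by apply: U; rewrite in_fsetU in_fset1 eqxx orbT.
  + by apply: IH2 => e Ee; apply: U; rewrite !in_fsetU Ee orbT.
- move=> x M t E G s a b _ IH xG et s0 _ U.
  have /= psib : unifies_eqn psi (TyEq (PVar b) (PArr s (PVar a))).
    by apply: U; rewrite in_fsetU in_fset1 eqxx orbT.
  rewrite /tree_of /= /sequent_map /= -/(env_of _) psib.
  apply: der_absI; [|exact: notin_finsupp_env_of|rewrite (concl_tree_of et)|].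
  + by apply: IH => e Ee; apply: U; rewrite in_fsetU Ee.
  + by rewrite env_of_ext.
  + by apply: seq_mset_neq0; rewrite !map_neq_nil; apply/eqP.
- move=> x M t E G a b c _ IH et xG _ _ _ U.
  have /= psic : unifies_eqn psi (TyEq (PVar c) (PArr [:: PVar b] (PVar a))).
    by apply: U; rewrite in_fsetU in_fset1 eqxx orbT.
  rewrite /tree_of /= /sequent_map /= -/(env_of _) psic /= seq_mset1.
  apply: der_absK (concl_tree_of et) _ _.
  + by apply: IH => e Ee; apply: U; rewrite in_fsetU Ee.
  + exact: notin_finsupp_env_of.
  + exact: strict_m_ty.
Qed.

End Soundness.

Theorem theorem4p6 (v : pvar -> tvar) (v_inj : injective v)
    (M : term) (Pi : ptree) (psi : pvar -> pretype) (G : penv) (a : pvar) :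
  InferStrong M Pi psi ->
  concl Pi = Sequent G M (inl (PVar a)) ->
  derivation (m_tree v (psubst_tree psi Pi)) /\
  concl (m_tree v (psubst_tree psi Pi)) =
    Sequent (m_env v (psubst_env psi G)) M
            (inl (m_ty v (psubst psi (PVar a)))).
Proof.
move=> /InferStrong_pseudo[E [pPi psiE psiS]] ePi; split.
  exact: pseudo_derivation psiS pPi psiE.
exact: concl_tree_of ePi.
Qed.
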